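(* Let $G$ be a commutative multiplicative hyperring with identity $1$, let $A$ be a $\mathcal{C}$-hyperideal of $G$ and let $S$ be a multiplicative closed subset of $G$ such that $A\cap S=\varnothing$. Then the following are equivalent. (i) $A$ is a strongly quasi $S$-primary hyperideal of $G$. (ii) $A$ is a strongly quasi $\mathfrak{S}$-primary hyperideal of $G$, where $\mathfrak{S}=\{a\in G: (a\circ b)\cap S\neq\varnothing\text{ for some }b\in G\}$. (iii) There exists $t\in S$ such that for every $u\in G$, $u^2\subseteq(A:t)$ or $(A:u)\subseteq(\mathrm{rad}(A):t)$. (iv) There exists $t\in S$ such that for all hyperideals $B,C$ of $G$, if $B\circ C\subseteq A$, then $t\circ\mathfrak{B}\subseteq A$ or $t\circ C\subseteq\mathrm{rad}(A)$, where $\mathfrak{B}=\bigcup_{b\in B}b^2$. (v) There exists $t\in S$ such that for every $u\in G$, $u^n\subseteq(A:t)$ for some $n\in\mathbb{N}$ or $\mathfrak{D}\subseteq(A:t)$, where $\mathfrak{D}=\bigcup_{d\in(A:u)}d^2$.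
   Context: A commutative multiplicative hyperring with identity is a triple $(G,+,\circ)$ where $(G,+)$ is an abelian group and $\circ$ assigns to each pair $(x,y)\in G\times G$ a non-empty subset $x\circ y\subseteq G$, such that for all $x,y,z\in G$: $(x\circ y)\circ z=x\circ(y\circ z)$; $(-x)\circ y=x\circ(-y)=-(x\circ y)$; $(y+z)\circ x\subseteq y\circ x+z\circ x$ and $x\circ(y+z)\subseteq x\circ y+x\circ z$; $x\circ y=y\circ x$; and there is $1\in G$ with $a\in 1\circ a$ for all $a\in G$. For non-empty subsets $X,Y\subseteq G$, $X\circ Y=\bigcup_{x\in X,y\in Y}x\circ y$ and $X+Y=\{x+y: x\in X,y\in Y\}$; elements are identified with singletons, and $u^n=u\circ\cdots\circ u$ ($n$ factors, $n\geq 1$). A hyperideal of $G$ is a non-empty $A\subseteq G$ with $x-y\in A$ for all $x,y\in A$ and $r\circ x\subseteq A$ for all $x\in A$, $r\in G$. A proper hyperideal $P$ is prime if $x\circ y\subseteq P$ ($x,y\in G$) implies $x\in P$ or $y\in P$. $\mathrm{rad}(A)$ is the intersection of all prime hyperideals containing $A$, and $\mathrm{rad}(A)=G$ if there are none. $A$ is a $\mathcal{C}$-hyperideal if for all $n\in\mathbb{N}$ and $a_1,\dots,a_n\in G$, $(a_1\circ\cdots\circ a_n)\cap A\neq\varnothing$ implies $a_1\circ\cdots\circ a_n\subseteq A$. For a hyperideal $B$ and $x\in G$, $(B:x)=\{y\in G: y\circ x\subseteq B\}$. A multiplicative closed subset (MCS) of $G$ is a subset $S\subseteq G$ containing $1$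 with $(s_1\circ s_2)\cap S\neq\varnothing$ for all $s_1,s_2\in S$. A hyperideal $A$ with $A\cap S=\varnothing$ is strongly quasi $S$-primary if there is $t\in S$ such that for all $u,v\in G$, $u\circ v\subseteq A$ implies $t\circ u^2\subseteq A$ or $t\circ v\subseteq\mathrm{rad}(A)$. *)

(* Defs.v *)
From HB Require Import structures.
From mathcomp Require Import all_boot all_algebra.
From mathcomp Require Import classical_sets.

Set Implicit Arguments.
Unset Strict Implicit.
Unset Printing Implicit Defensive.

Import GRing.Theory.
Local Open Scope ring_scope.
Local Open Scope classical_set_scope.

Definition hop_set (T : Type) (op : T -> T -> set T) (X Y : set T) : set T :=
  \bigcup_(x in X) \bigcup_(y in Y) op x y.

HB.mixin Record Zmodule_isComHyperring G of GRing.Zmodule G := {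
  hone : G;
  hmul : G -> G -> set G;
  hmul_nonempty : forall x y : G, hmul x y !=set0;
  hmulA : forall x y z : G,
    hop_set hmul (hmul x y) [set z] = hop_set hmul [set x] (hmul y z);
  hmulNl : forall x y : G, hmul (- x) y = [set - z | z in hmul x y];
  hmulNr : forall x y : G, hmul x (- y) = [set - z | z in hmul x y];
  hmulDl : forall x y z : G,
    hmul (y + z) x `<=` [set a + b | a in hmul y x & b in hmul z x];
  hmulDr : forall x y z : G,
    hmul x (y + z) `<=` [set a + b | a in hmul x y & b in hmul x z];
  hmulC : forall x y : G, hmul x y = hmul y x;
  hmul1 : forall a : G, hmul hone a a
}.

#[short(type="comHyperringType")]
HB.structure Definition ComHyperring :=
  { G of Zmodule_isComHyperring G & GRing.Zmodule G }.

Notation "x *h y" := (hmul x y) (at level 40, left associativity) : ring_scope.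
Notation "X *H Y" := (hop_set hmul X Y)
  (at level 40, left associativity) : ring_scope.

(* Products have at least one factor: [hprod a1 [:: a2; ...; an]] is
   a1 o ... o an, associated to the left. *)
Definition hprod (G : comHyperringType) (a : G) (s : seq G) : set G :=
  foldl (fun (X : set G) (b : G) => X *H [set b]) [set a] s.

(* Meaningful for n >= 1 only; the value at n = 0 is a junk one, [set u]. *)
Definition hpow (G : comHyperringType) (u : G) (n : nat) : set G :=
  hprod u (nseq n.-1 u).

Definition hyperideal (G : comHyperringType) (A : set G) : Prop :=
  [/\ A !=set0,
      forall x y, A x -> A y -> A (x - y)
    & forall r x, A x -> r *h x `<=` A].

Definition prime_hyperideal (G : comHyperringType) (P : set G) : Prop :=
  [/\ hyperideal P,
      P <> setT
    & forall x y, x *h y `<=` P -> P x \/ P y].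

(* The intersection of the empty family is [setT]. *)
Definition hrad (G : comHyperringType) (A : set G) : set G :=
  \bigcap_(P in [set P | prime_hyperideal P /\ A `<=` P]) P.

Definition C_hyperideal (G : comHyperringType) (A : set G) : Prop :=
  hyperideal A /\
  forall (a : G) (s : seq G), hprod a s `&` A !=set0 -> hprod a s `<=` A.

Definition hcolon (G : comHyperringType) (B : set G) (x : G) : set G :=
  [set y | y *h x `<=` B].

Definition mcs (G : comHyperringType) (S : set G) : Prop :=
  S hone /\ forall s1 s2, S s1 -> S s2 -> (s1 *h s2) `&` S !=set0.

Definition strongly_quasi_primary (G : comHyperringType) (S A : set G) : Prop :=
  [/\ mcs S, hyperideal A, A `&` S = set0
    & exists2 t, S t & forall u v, u *h v `<=` A ->
        [set t] *H hpow u 2 `<=` A \/ t *h v `<=` hrad A].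

Definition mcs_saturation (G : comHyperringType) (S : set G) : set G :=
  [set a | exists b, (a *h b) `&` S !=set0].

(* Main.v *)
Require Import Defs.
From HB Require Import structures.
From mathcomp Require Import all_boot all_algebra.
From mathcomp Require Import boolp classical_sets.

Set Implicit Arguments.
Unset Strict Implicit.
Unset Printing Implicit Defensive.

Import GRing.Theory.
Local Open Scope ring_scope.
Local Open Scope classical_set_scope.

(** The equivalence is proved around the cycle (i) -> (ii) -> (iii) -> (iv) ->
    (v) -> (i).  The first three steps are formal.  An element [s] of [S] with
    [s] in [t o b] is a multiple of [t], so a condition holding for the
    multiplier [t] in the saturation of [S] holds for the multiplier [s] in [S]
    ([hyperideal_dvd]); and condition (iii) at all elements of a hyperideal [B]
    is (iv) for [B].

    The weight lies on (iv) -> (v).  Applied to the hyperideals [B = (A : v)]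
    and [C = (A : B)], which contains [v], condition (iv) gives back the
    elementwise condition: if [u o v] is inside [A] then [t o u^2] is inside [A]
    or [t o v] is inside [rad A].  With [B = (A : u)] it leaves the case where
    [t o u] is inside [rad A].  Since [A] is a C-hyperideal, [t^n o u^n] is then
    inside [A] for some [n], but the factor [t^n] depends on [u].  It is traded
    for [t] by a second use of the elementwise condition: choose [s] in both
    [t^n] and [S], and [w] in [u^n].  As [w o s] is inside [A], either
    [t o w^2] is inside [A], and then so is [t o u^(2n)] by the C-property, or
    [t o s] is inside [rad A].  The latter is impossible, because [t o s] meets
    [S] and [rad A] does not.

    Both facts about [rad A] used here -- that it avoids [S], and that its
    elements have a power inside [A] -- are instances of Krull's theorem
    ([exists_prime_avoiding]): a hyperideal disjoint from a non-empty set in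
    which every product of two elements has a representative is contained in a
    prime hyperideal disjoint from that set.

    For (v) -> (i), a prime hyperideal containing [v^n o t] contains [v] or
    [t]; hence [t o v] is inside [rad A]. *)

(** * Products of sets *)

Section SetProduct.
Variable G : comHyperringType.
Implicit Types (x y z : G) (X Y Z : set G).

Lemma mem_hop X Y x y z : X x -> Y y -> (x *h y) z -> (X *H Y) z.
Proof. by move=> Xx Yy xyz; exists x => //; exists y. Qed.

Lemma hop_subP X Y Z :
  X *H Y `<=` Z <-> forall x y, X x -> Y y -> x *h y `<=` Z.
Proof.
split=> [XYZ x y Xx Yy z xyz|XYZ z [x Xx [y Yy xyz]]].
  exact/XYZ/(mem_hop Xx Yy xyz).
exact: (XYZ x y).
Qed.

Lemma hop_subset X X' Y Y' : X `<=` X' -> Y `<=` Y' -> X *H Y `<=` X' *H Y'.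
Proof.
move=> XX' YY' z [x Xx [y Yy xyz]].
exact: mem_hop (XX' _ Xx) (YY' _ Yy) xyz.
Qed.

Lemma hop1 x y : [set x] *H [set y] = x *h y.
Proof. by rewrite /hop_set !bigcup_set1. Qed.

Lemma hopC X Y : X *H Y = Y *H X.
Proof.
apply/seteqP; split=> z [x Xx [y Yy xyz]];
  by apply: (mem_hop Yy Xx); rewrite hmulC.
Qed.

Lemma hopA X Y Z : X *H (Y *H Z) = X *H Y *H Z.
Proof.
apply/seteqP; split=> w.
- move=> [x Xx [v [y Yy [z Zz yzv]] xvw]].
  have : ([set x] *H (y *h z)) w by exact: mem_hop xvw.
  rewrite -hmulA => -[v' xyv' [_ -> v'zw]].
  exact: mem_hop (mem_hop Xx Yy xyv') Zz v'zw.
- move=> [v [x Xx [y Yy xyv]] [z Zz vzw]].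
  have : ((x *h y) *H [set z]) w by exact: mem_hop vzw.
  rewrite hmulA => -[_ -> [v' yzv' xv'w]].
  exact: mem_hop Xx (mem_hop Yy Zz yzv') xv'w.
Qed.

Lemma hopACA X Y Z W : X *H Y *H (Z *H W) = X *H Z *H (Y *H W).
Proof. by rewrite -!hopA (hopA Y) (hopC Y) -(hopA Z). Qed.

Lemma hprod_rcons x (s : seq G) y : hprod x (rcons s y) = hprod x s *H [set y].
Proof. by rewrite /hprod foldl_rcons. Qed.

Lemma hprod_cat x (s : seq G) y (r : seq G) :
  hprod x (s ++ y :: r) = hprod x s *H hprod y r.
Proof.
elim/last_ind: r => [|r z IH]; first by rewrite cats1 hprod_rcons.
by rewrite -rcons_cons -rcons_cat !hprod_rcons IH hopA.
Qed.

Lemma hpow1 x : hpow x 1 = [set x].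
Proof. by []. Qed.

Lemma hpow2 x : hpow x 2 = x *h x.
Proof. by rewrite -hop1. Qed.

Lemma hpowD x m n : hpow x (m.+1 + n.+1) = hpow x m.+1 *H hpow x n.+1.
Proof. by rewrite /hpow -hprod_cat addSn nseqD. Qed.

Lemma hpowS x n : hpow x n.+2 = hpow x n.+1 *H [set x].
Proof. by rewrite -hpow1 -hpowD addn1. Qed.

Lemma hpow_hmul_sub x y z n :
  (x *h y) z -> hpow z n.+1 `<=` hpow x n.+1 *H hpow y n.+1.
Proof.
move=> xyz; elim: n => [|n IH]; first by rewrite !hpow1 hop1 => _ ->.
rewrite !hpowS hopACA hop1; apply: hop_subset => //.
by move=> _ ->.
Qed.

Lemma hprod_nonempty x (s : seq G) : hprod x s !=set0.
Proof.
elim/last_ind: s => [|s y [z sz]]; first by exists x.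
have [w zyw] := hmul_nonempty z y.
by exists w; rewrite hprod_rcons; apply: mem_hop zyw.
Qed.

End SetProduct.

(** * Hyperideals and colons *)

Section Hyperideals.
Variable G : comHyperringType.
Implicit Types (x y z t u v : G) (A B C I P S T : set G).

Lemma hyperideal0 A : hyperideal A -> A 0.
Proof. by case=> -[x Ax] subA _; rewrite -(subrr x); exact: subA. Qed.

Lemma hyperidealMl A x y : hyperideal A -> A x -> x *h y `<=` A.
Proof. by case=> _ _ mulA Ax; rewrite hmulC; exact: mulA. Qed.

Lemma hyperideal_bigcap (F : set (set G)) :
  (forall I, F I -> hyperideal I) -> hyperideal (\bigcap_(I in F) I).
Proof.
move=> Fid; split.
- by exists 0 => I /Fid; exact: hyperideal0.
- move=> x y Fx Fy I FI; case: (Fid _ FI) => _ subI _.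
  exact: (subI x y (Fx _ FI) (Fy _ FI)).
- move=> r x Fx z rxz I FI; case: (Fid _ FI) => _ _ mulI.
  exact: (mulI r x (Fx _ FI)).
Qed.

Lemma hyperideal_hrad A : hyperideal (hrad A).
Proof. by apply: hyperideal_bigcap => P [[]]. Qed.

Lemma hyperideal_hcolon A x : hyperideal A -> hyperideal (hcolon A x).
Proof.
move=> idA; have [_ subA mulA] := idA; split.
- by exists 0; apply: hyperidealMl => //; exact: hyperideal0.
- move=> y z Ayx Azx w /hmulDl [a ya [b]].
  by rewrite hmulNl => -[c zc <-] <-; apply: subA; [exact: Ayx|exact: Azx].
- move=> r y Ayx z ryz; apply: (@subset_trans _ ([set r] *H (y *h x))).
    by rewrite -hmulA => w zxw; exact: mem_hop zxw.
  by apply/hop_subP => _ w -> yxw; apply: mulA; apply: Ayx.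
Qed.

(** The multiplier of a colon condition may be replaced by any of its
    multiples. *)
Lemma hyperideal_dvd I t b s v :
  hyperideal I -> (t *h b) s -> t *h v `<=` I -> s *h v `<=` I.
Proof.
move=> idI tbs tvI; rewrite -hop1.
apply: (@subset_trans _ ((t *h b) *H [set v])).
  by apply: hop_subset => // x ->.
rewrite -hop1 -hopA (hopC [set b]) hopA hop1.
by apply/hop_subP => x y tvx _; apply: hyperidealMl => //; exact: tvI.
Qed.

(** For a subset [B], this is the set [(A : B)].  Together with [(A : v)] it
    gives two hyperideals, one containing every [u] with [u o v] inside [A] and
    the other containing [v], whose product is still inside [A]; this makes
    generated hyperideals, and hence sums of products, unnecessary. *)
Definition hcolon_set A B : set G := [set c | forall b, B b -> b *h c `<=` A].

Lemma hyperideal_hcolon_set A B : hyperideal A -> hyperideal (hcolon_set A B).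
Proof.
move=> idA.
suff -> : hcolon_set A B = \bigcap_(I in [set hcolon A b | b in B]) I.
  by apply: hyperideal_bigcap => _ [b _ <-]; exact: hyperideal_hcolon.
apply/seteqP; split=> c Bc; last first.
  by move=> b Bb; rewrite hmulC; apply: (Bc (hcolon A b)); exists b.
by move=> _ [b Bb <-]; rewrite /hcolon /= hmulC; exact: Bc.
Qed.

Lemma hop_hcolon_set A B : B *H hcolon_set A B `<=` A.
Proof. by apply/hop_subP => b c Bb; exact. Qed.

Lemma hcolon_set_hcolon A v : hcolon_set A (hcolon A v) v.
Proof. by move=> b. Qed.

Lemma C_hyperideal_hpowM A x y m n : C_hyperideal A ->
  (hpow x m.+1 *H hpow y n.+1) `&` A !=set0 ->
  hpow x m.+1 *H hpow y n.+1 `<=` A.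
Proof. by case=> _ CA; rewrite -hprod_cat; exact: CA. Qed.

(** * Prime hyperideals and radicals *)

(** Let [P] be maximal among the hyperideals containing [A] and disjoint from
    [T].  If [x o y] is inside [P], the hyperideals [P1 = (P : y)] and
    [P2 = (P : P1)] contain [P] together with [x] and [y] respectively, and
    [P1 o P2] is inside [P].  If neither [x] nor [y] were in [P], both would
    meet [T], and so would [P]. *)
Lemma exists_prime_avoiding A T : hyperideal A -> A `&` T = set0 -> T !=set0 ->
  (forall x y, T x -> T y -> (x *h y) `&` T !=set0) ->
  exists P, [/\ prime_hyperideal P, A `<=` P & P `&` T = set0].
Proof.
move=> idA AT [t0 Tt0] mulT.
(* Joining [A] to the members of a chain makes the empty chain harmless. *)
pose good M := hyperideal (A `|` M) /\ (A `|` M) `&` T = set0.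
have [|M [[idP PT] maxM]] := @Zorn_bigcup G good.
  move=> F Fgood Ftot; split; last first.
    rewrite -subset0 => x [AFx Tx].
    case: AFx => [Ax|[X FX Xx]]; first by rewrite -AT; split.
    by case: (Fgood X FX) => _ <-; split=> //; right.
  have [_ subA mulA] := idA; split.
  - by exists 0; left; exact: hyperideal0.
  - have sub1 X x y : F X -> (A `|` X) x -> (A `|` X) y ->
        (A `|` \bigcup_(X in F) X) (x - y).
      move=> FX Xx Xy; case: (Fgood X FX) => -[_ subX _] _.
      by case: (subX x y Xx Xy) => ?; [left|right; exists X].
    move=> x y [Ax|[X FX Xx]] [Ay|[Y FY Yy]].
    + by left; exact: subA.
    + by apply: (sub1 Y) => //; [left|right].
    + by apply: (sub1 X) => //; [right|left].
    + case: (Ftot X Y FX FY) => [XY|YX].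
        by apply: (sub1 Y) => //; right=> //; exact: XY.
      by apply: (sub1 X) => //; right=> //; exact: YX.
  - move=> r x [Ax|[X FX Xx]] z rxz; first by left; exact: mulA rxz.
    case: (Fgood X FX) => -[_ _ mulX] _.
    by case: (mulX r x (or_intror Xx) z rxz) => ?; [left|right; exists X].
set P := A `|` M in idP PT.
have maxP Q x : hyperideal Q -> P `<=` Q -> Q x -> ~ P x -> Q `&` T !=set0.
  move=> idQ PQ Qx Px; apply: contrapT => QT.
  have AQ : A `|` Q = Q by apply/setUidPr => z Az; apply: PQ; left.
  apply: (maxM Q); last first.
    rewrite /good AQ; split=> //.
    by rewrite -subset0 => z QTz; apply: QT; exists z.
  split; first by move=> z Mz; apply: PQ; right.
  by move=> QM; apply: Px; right; exact: QM.
exists P; split=> //; last by move=> z; left.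
split=> // [PE|x y xyP].
  have : (P `&` T) t0 by split=> //; rewrite PE.
  by rewrite PT.
apply: contrapT => /not_orP [Px Py].
pose P1 := hcolon P y; pose P2 := hcolon_set P P1.
have [p1 [P1p Tp1]] : P1 `&` T !=set0.
  apply: (maxP _ x) => //; first exact: hyperideal_hcolon.
  by move=> p Pp; exact: hyperidealMl.
have [p2 [P2p Tp2]] : P2 `&` T !=set0.
  apply: (maxP _ y) => //; first exact: hyperideal_hcolon_set.
  by move=> p Pp b _; case: idP => _ _; apply.
have [z [p12z Tz]] := mulT _ _ Tp1 Tp2.
have : (P `&` T) z by split=> //; exact: (P2p p1).
by rewrite PT.
Qed.

Lemma hrad_avoid A T : hyperideal A -> A `&` T = set0 ->
  (forall x y, T x -> T y -> (x *h y) `&` T !=set0) -> hrad A `&` T = set0.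
Proof.
move=> idA AT mulT; rewrite -subset0 => x [radx Tx].
have [|P [primeP AP PT]] := exists_prime_avoiding idA AT _ mulT; first by exists x.
by rewrite -PT; split=> //; apply: radx.
Qed.

(** The powers of [x] form a set closed under products, so if [x] lies in every
    prime hyperideal above [A] some power meets [A]; the C-property turns
    meeting into inclusion. *)
Lemma hrad_C_hyperideal A x : C_hyperideal A -> hrad A x ->
  exists n, hpow x n.+1 `<=` A.
Proof.
move=> [idA CA] radx; apply: contrapT => noA.
pose T := \bigcup_n hpow x n.+1.
suff RT : hrad A `&` T = set0.
  by have : (hrad A `&` T) x by [split=> //; exists 0%N]; rewrite RT.
apply: hrad_avoid => // [|y z [m _ xmy] [n _ xnz]].
  rewrite -subset0 => y [Ay [n _ xny]]; apply: noA; exists n.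
  by apply: CA; exists y.
have [w yzw] := hmul_nonempty y z.
exists w; split=> //; exists (m + n.+1)%N => //.
by rewrite -addSn hpowD; exact: mem_hop yzw.
Qed.

Lemma prime_hyperideal_hpow P x n :
  prime_hyperideal P -> hpow x n.+1 `<=` P -> P x.
Proof.
move=> [idP _ primeP]; elim: n => [|n IH]; first by rewrite hpow1; exact.
rewrite hpowS => /hop_subP xnP; apply: contrapT => Px.
apply: (Px); apply: IH => y xny.
by have [] := primeP y x (xnP y x xny erefl).
Qed.

Lemma prime_hyperideal_hcolon_hpow P t x n :
  prime_hyperideal P -> hpow x n.+1 `<=` hcolon P t -> P t \/ P x.
Proof.
move=> primeP xnP; have [Pt|Pt] := pselect (P t); [by left|right].
apply: (prime_hyperideal_hpow (n := n) primeP) => y xny.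
by case: primeP => _ _ /(_ y t (xnP y xny)) [].
Qed.

(** * Multiplicative closed sets *)

Lemma mcs_hpow S t n : mcs S -> S t -> hpow t n.+1 `&` S !=set0.
Proof.
move=> [_ mulS] St; elim: n => [|n [x [tnx Sx]]]; first by exists t.
have [y [xty Sy]] := mulS x t Sx St.
by exists y; split=> //; rewrite hpowS; exact: mem_hop xty.
Qed.

Lemma sub_mcs_saturation S : S `<=` mcs_saturation S.
Proof. by move=> s Ss; exists hone, s; split=> //; rewrite hmulC; exact: hmul1. Qed.

(** If [a o b] and [c o d] have representatives in [S], so does their product
    [(a o c) o (b o d)]; hence some element of [a o c] is a divisor of an
    element of [S]. *)
Lemma mcs_saturationP S : mcs S -> mcs (mcs_saturation S).
Proof.
move=> [S1 mulS]; split; first exact: sub_mcs_saturation.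
move=> a c [b [s [abs Ss]]] [d [r [cdr Sr]]].
have [w [srw Sw]] := mulS _ _ Ss Sr.
have : ((a *h b) *H (c *h d)) w by exact: mem_hop srw.
rewrite -!hop1 hopACA !hop1 => -[x acx [y bdy xyw]].
by exists x; split=> //; exists y, w.
Qed.

Lemma mcs_saturation_disjoint A S : hyperideal A -> A `&` S = set0 ->
  A `&` mcs_saturation S = set0.
Proof.
move=> idA AS; rewrite -subset0 => a [Aa [b [s [abs Ss]]]].
suff : (A `&` S) s by rewrite AS.
by split=> //; exact: (hyperidealMl idA Aa abs).
Qed.

End Hyperideals.

(** * The equivalence *)

Section Conditions.
Variables (G : comHyperringType) (A S : set G).

Lemma hop1_subP (I : set G) (t : G) (X : set G) :
  [set t] *H X `<=` I <-> X `<=` hcolon I t.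
Proof.
rewrite hopC hop_subP; split=> [XI x Xx|XI x _ Xx ->]; first exact: XI.
exact: XI.
Qed.

(** The double colon turns a condition on pairs of hyperideals into the
    elementwise one. *)
Lemma elementwise_of_hyperidealwise (t : G) : hyperideal A ->
  (forall B C : set G, hyperideal B -> hyperideal C -> B *H C `<=` A ->
     [set t] *H (\bigcup_(b in B) hpow b 2) `<=` A \/
     [set t] *H C `<=` hrad A) ->
  forall v, \bigcup_(b in hcolon A v) hpow b 2 `<=` hcolon A t \/
            t *h v `<=` hrad A.
Proof.
move=> idA H v.
have [] := H (hcolon A v) (hcolon_set A (hcolon A v)) _ _
             (@hop_hcolon_set _ _ _).
- exact: hyperideal_hcolon.
- exact: hyperideal_hcolon_set.
- by move=> /hop1_subP; left.
- move=> /hop1_subP AvC; right; rewrite hmulC.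
  by apply: AvC; exact: hcolon_set_hcolon.
Qed.

(** The exponent, and with it the multiplier [t^n] obtained from the radical,
    depends on [u]; squaring once more brings the multiplier back to [t]. *)
Lemma hpow_hcolon_of_hrad (t u : G) :
  C_hyperideal A -> mcs S -> A `&` S = set0 -> S t ->
  (forall v, \bigcup_(b in hcolon A v) hpow b 2 `<=` hcolon A t \/
             t *h v `<=` hrad A) ->
  t *h u `<=` hrad A ->
  exists2 n, (1 <= n)%N & hpow u n `<=` hcolon A t.
Proof.
move=> CA mcsS AS St elt turad.
have [idA _] := CA; have [_ mulS] := mcsS.
have [x tux] := hmul_nonempty t u.
have [n xnA] := hrad_C_hyperideal CA (turad x tux).
have tunA : hpow t n.+1 *H hpow u n.+1 `<=` A.
  apply: C_hyperideal_hpowM => //.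
  have [y xny] := hprod_nonempty x (nseq n x).
  by exists y; split; [exact: (hpow_hmul_sub tux xny)|exact: xnA].
have [s [tns Ss]] := mcs_hpow n mcsS St.
have [w unw] := hprod_nonempty u (nseq n u).
have wsA : hcolon A s w.
  by rewrite /hcolon /= hmulC; move/hop_subP: tunA; apply.
case: (elt s) => [wA|tsrad]; last first.
  have [r [tsr Sr]] := mulS t s St Ss.
  have : (hrad A `&` S) r by split=> //; exact: tsrad.
  by rewrite hrad_avoid.
exists (n.+1 + n.+1)%N => //; apply/hop1_subP.
rewrite -hpow1; apply: C_hyperideal_hpowM => //.
have [y wwy] := hmul_nonempty w w.
have [z ytz] := hmul_nonempty y t.
exists z; split.
  apply: (@mem_hop _ _ _ t y) => //; last by rewrite hmulC.
  by rewrite -/(hpow u (n.+1 + n.+1)) hpowD; exact: mem_hop wwy.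
by apply: (wA y _ z ytz); exists w => //; rewrite hpow2.
Qed.

End Conditions.

Theorem theorem4p5 (G : comHyperringType) (A S : set G)
  (hA : C_hyperideal A) (hS : mcs S) (hAS : A `&` S = set0) :
  [<-> strongly_quasi_primary S A;
       strongly_quasi_primary (mcs_saturation S) A;
       exists2 t, S t & forall u : G,
         hpow u 2 `<=` hcolon A t \/ hcolon A u `<=` hcolon (hrad A) t;
       exists2 t, S t & forall B C : set G,
         hyperideal B -> hyperideal C -> B *H C `<=` A ->
         [set t] *H (\bigcup_(b in B) hpow b 2) `<=` A \/
         [set t] *H C `<=` hrad A;
       exists2 t, S t & forall u : G,
         (exists2 n : nat, (1 <= n)%N & hpow u n `<=` hcolon A t) \/
         \bigcup_(d in hcolon A u) hpow d 2 `<=` hcolon A t].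
Proof.
have [idA _] := hA.
tfae.
- move=> [_ _ _ [t St tP]]; split=> //.
  + exact: mcs_saturationP.
  + exact: mcs_saturation_disjoint.
  + by exists t => //; exact: sub_mcs_saturation.
- move=> [_ _ _ [t [b [s [tbs Ss]]] tP]]; exists s => // u.
  have [tu|tu] := pselect (hpow u 2 `<=` hcolon A t).
    left=> y /tu; rewrite /hcolon /= !(hmulC y).
    exact: (hyperideal_dvd idA tbs).
  right=> v Avu; rewrite /hcolon /= hmulC.
  apply: (hyperideal_dvd (@hyperideal_hrad _ _) tbs).
  have [|/hop1_subP|//] := tP u v; last by [].
  by rewrite hmulC.
- move=> [t St tP]; exists t => // B C _ _ /hop_subP BCA.
  have [Bt|/existsNP [b /not_implyP [Bb bt]]] :=
    pselect (forall b, B b -> hpow b 2 `<=` hcolon A t).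
    by left; apply/hop1_subP => x [b Bb]; exact: Bt.
  right; apply/hop1_subP => c Cc.
  have [//|] := tP b; apply; rewrite /hcolon /= hmulC; exact: BCA.
- move=> [t St tP]; exists t => // u.
  have elt := elementwise_of_hyperidealwise idA tP.
  case: (elt u) => [|turad]; [by right|left].
  exact: (hpow_hcolon_of_hrad hA hS).
- move=> [t St tP]; split=> //; exists t => // u v uvA.
  case: (tP v) => [[[//|n] _ vnA]|vA].
    right=> x tvx P [primeP AP]; have [idP _ _] := primeP.
    have [|Pt|Pv] := @prime_hyperideal_hcolon_hpow _ P t v n primeP.
    + by move=> y vny; exact: subset_trans (vnA y vny) AP.
    + exact: (hyperidealMl idP Pt tvx).
    + by case: idP => _ _ /(_ t v Pv x tvx).
  by left; apply/hop1_subP => y uuy; apply: vA; exists u.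
Qed.
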